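(* Let $n\geq 2$, let $K_n$ be the complete graph on $n$ vertices, and let $P$ be a graph admitting a covering that satisfies condition A; set $\kappa=\mathrm{cov}_A(P)$. Then $A_{ucg}(K_n,P)=\kappa$ if and only if $\mathrm{cov}_{AB}(P)=\kappa$.
   Context: All graphs are finite and simple. $d(u,v)$ is the distance in the relevant graph ($\infty$ if no path); for a vertex $p$ and vertex sets $S,T$, $d(p,S)=d(S,p)=\min_{s\in S}d(p,s)$ and $d(S,T)=\min_{s\in S,t\in T}d(s,t)$. Eccentricity $e(v)=\max_u d(u,v)$. For a graph $H$: the center $Z(H)$ is the set of vertices of minimum eccentricity; $EC(v)=\{x: d(v,x)=e(v)\}$; the centered periphery is $CP(H)=\bigcup_{z\in Z(H)} EC(z)$; $\langle S\rangle$ is the induced subgraph on $S$. $H$ is a uniform central graph (UCG) if $EC(c)$ is the same for all $c\in Z(H)$. $I(H)=V(H)\setminus(Z(H)\cup CP(H))$. For graphs $C,P$, $A_{ucg}(C,P)$ is the minimum of $|I(H)|$ over all UCGs $H$ with $\langle Z(H)\rangle\cong C$ and $\langle CP(H)\rangle\cong P$ ($\infty$ if none). A covering of $P$ is a family $\{P_1,\dots,P_k\}$ of subsets of $V(P)$ with $\bigcup P_i=V(P)$; $k$ is its size. Distances below are in $P$. Condition A: for each $i$ there is a vertex $p\notin P_i$ with $d(P_i,p)\geq 2$. Condition B: for every $i$ and every $p\in P_i$, either there is a vertex $p'\notin P_i$ with $d(p,p')\geq 3$, or there is $j\neq i$ with $d(p,P_j)\geq 2$. $\mathrm{cov}_A(P)$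 is the smallest size of a covering of $P$ satisfying condition A, and $\mathrm{cov}_{AB}(P)$ the smallest size of a covering satisfying both conditions A and B. *)

(* Defs.v *)
From HB Require Import structures.
From mathcomp Require Import all_boot all_order.
From mathcomp Require Import boolp.

Set Implicit Arguments.
Unset Strict Implicit.
Unset Printing Implicit Defensive.

Import Order.TTheory.

Local Open Scope order_scope.

Inductive enat := Fin of nat | Infty.

Definition enat_to_option (x : enat) : option nat :=
  if x is Fin n then Some n else None.
Definition option_to_enat (x : option nat) : enat :=
  if x is Some n then Fin n else Infty.

Lemma enat_to_optionK : cancel enat_to_option option_to_enat.
Proof. by case. Qed.

HB.instance Definition _ := Choice.copy enat (can_type enat_to_optionK).

Definition le_enat (x y : enat) : bool :=
  match x, y with
  | _, Infty => true
  | Infty, Fin _ => false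
  | Fin m, Fin n => (m <= n)%N
  end.
Definition lt_enat (x y : enat) : bool := (y != x) && le_enat x y.
Definition min_enat (x y : enat) : enat := if lt_enat x y then x else y.
Definition max_enat (x y : enat) : enat := if lt_enat x y then y else x.

Lemma le_enat_anti : antisymmetric le_enat.
Proof. by case=> [m|] [n|] //= mn; congr Fin; apply: anti_leq. Qed.

Lemma le_enat_trans : transitive le_enat.
Proof. by case=> [m|] [n|] [p|] //=; apply: leq_trans. Qed.

Lemma le_enat_total : total le_enat.
Proof. by case=> [m|] [n|] //=; apply: leq_total. Qed.

Fact enat_display : Order.disp_t. Proof. exact: (Order.Disp tt tt). Qed.

HB.instance Definition _ := Order.isOrder.Build enat_display enat
  (fun x y => erefl (lt_enat x y)) (fun x y => erefl (min_enat x y))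
  (fun x y => erefl (max_enat x y)) le_enat_anti le_enat_trans le_enat_total.

(* The minimum of a set of naturals, [Infty] if the set is empty. *)
Definition min_nat (S : nat -> Prop) : enat :=
  match pselect (exists n, `[< S n >]) with
  | left exS => Fin (ex_minn exS)
  | right _ => Infty
  end.

Record sgraph := SGraph {
  vertex :> finType;
  adj : rel vertex;
  adj_sym : symmetric adj;
  adj_irr : irreflexive adj }.
Arguments adj {s}.

Definition iso (G H : sgraph) : Prop :=
  exists2 f : G -> H, bijective f & forall x y, adj (f x) (f y) = adj x y.

Section Complete.
Variable n : nat.
Definition complete_adj : rel 'I_n := fun x y => x != y.
Lemma complete_adj_sym : symmetric complete_adj.
Proof. by move=> x y; rewrite /complete_adj eq_sym. Qed.
Lemma complete_adj_irr : irreflexive complete_adj.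
Proof. by move=> x; rewrite /complete_adj eqxx. Qed.
Definition complete := SGraph complete_adj_sym complete_adj_irr.
End Complete.

Section Induced.
Variables (G : sgraph) (S : {set G}).
Definition induced_adj : rel {x : G | x \in S} :=
  fun x y => adj (val x) (val y).
Lemma induced_adj_sym : symmetric induced_adj.
Proof. by move=> x y; apply: adj_sym. Qed.
Lemma induced_adj_irr : irreflexive induced_adj.
Proof. by move=> x; apply: adj_irr. Qed.
Definition induced := SGraph induced_adj_sym induced_adj_irr.
End Induced.

Section Metric.
Variable G : sgraph.
Implicit Types (u v p : G) (S : {set G}).

Definition walk k u v : Prop :=
  exists s : seq G, [/\ size s = k, path adj u s & last u s = v].

Definition dist u v : enat := min_nat (fun k => walk k u v).

(* [Infty] when [S] is empty. *)
Definition dist_set p S : enat := \big[Order.min/Infty]_(s in S) dist p s.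

Definition ecc v : enat := \big[Order.max/Fin 0]_(u : G) dist u v.

Definition center : {set G} := [set v | [forall u, ecc v <= ecc u]].

Definition EC v : {set G} := [set x | dist v x == ecc v].

Definition CP : {set G} := \bigcup_(z in center) EC z.

Definition UCG : Prop :=
  forall c c' : G, c \in center -> c' \in center -> EC c = EC c'.

Definition intermediate : {set G} := ~: (center :|: CP).

End Metric.
Arguments center : clear implicits.
Arguments CP : clear implicits.
Arguments UCG : clear implicits.
Arguments intermediate : clear implicits.

Definition A_ucg (C P : sgraph) : enat :=
  min_nat (fun m => exists H : sgraph,
    [/\ UCG H, iso (induced (center H)) C, iso (induced (CP H)) P
      & #|intermediate H| = m]).

Section Coverings.
Variable P : sgraph.

Definition covering k (F : 'I_k -> {set P}) : Prop :=
  \bigcup_(i < k) F i = [set: P].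

Definition condA k (F : 'I_k -> {set P}) : Prop :=
  forall i, exists2 p : P, p \notin F i & Fin 2 <= dist_set p (F i).

Definition condB k (F : 'I_k -> {set P}) : Prop :=
  forall i (p : P), p \in F i ->
    (exists2 p' : P, p' \notin F i & Fin 3 <= dist p p')
    \/ (exists2 j, j != i & Fin 2 <= dist_set p (F j)).

Definition cov_A : enat :=
  min_nat (fun k => exists2 F : 'I_k -> {set P}, covering F & condA F).

Definition cov_AB : enat :=
  min_nat (fun k => exists F : 'I_k -> {set P},
    [/\ covering F, condA F & condB F]).

End Coverings.

(* Main.v *)
(** If [H] is a uniform central graph with center [K_n] and [c] is central, the
    radius [r] is finite and at least 2. For a noncentral neighbour [v] of [c], let
    [P_v] be the set of centered-peripheral vertices at distance at most [r - 1]
    from [v]. These sets cover [CP H] and satisfy condition A: since [v] is not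
    central, some [x] has [d(v, x) > r], hence [d(c, x) = r]. If [r >= 3], the last
    intermediate vertex on a geodesic from [c] to [CP H] is intermediate but not a
    neighbour of [c], so the covering has fewer members than [H] has intermediate
    vertices; if [r = 2], condition B holds because peripheral vertices have
    eccentricity at least 3. Conversely, a covering satisfying A and B, shrunk to a
    partition, gives a graph of radius 2 with one intermediate vertex per member. *)

Require Import Defs.
From mathcomp Require Import all_boot all_order.
From mathcomp Require Import boolp.

Set Implicit Arguments.
Unset Strict Implicit.
Unset Printing Implicit Defensive.

Import Order.TTheory.

(** * Extended naturals *)

Lemma min_nat_le (S : nat -> Prop) k : S k -> (min_nat S <= Fin k)%O.
Proof.
rewrite /min_nat => Sk; case: pselect => [exS|[]]; last by exists k; apply/asboolP.
by case: ex_minnP => m _; apply; apply/asboolP.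
Qed.

Lemma min_natP (S : nat -> Prop) k : min_nat S = Fin k -> S k.
Proof.
rewrite /min_nat; case: pselect => // exS [<-].
by case: ex_minnP => m /asboolP.
Qed.

Lemma min_nat_leP (S : nat -> Prop) k :
  reflect (exists2 j, j <= k & S j) (min_nat S <= Fin k)%O.
Proof.
apply: (iffP idP) => [|[j jk /min_nat_le Sj]]; last exact: le_trans Sj _.
by case E: min_nat => [j|] // jk; exists j => //; apply: min_natP.
Qed.

Lemma min_nat_eqFin (S : nat -> Prop) k :
  S k -> (forall j, S j -> k <= j) -> min_nat S = Fin k.
Proof.
move=> Sk minS; apply/le_anti; rewrite min_nat_le //=.
by case E: min_nat => [j|] //; apply: minS; apply: min_natP.
Qed.

(** Lower bounds on distances are handled as negated upper bounds, since a walk witnesses an upper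
    bound. *)
Lemma FinS_le k x : (Fin k.+1 <= x)%O = ~~ (x <= Fin k)%O.
Proof. by case: x => // m; rewrite !/(_ <= _)%O /= ltnNge. Qed.

Lemma le_Fin m k : (Fin m <= Fin k)%O = (m <= k).
Proof. by []. Qed.

(** * Distances and eccentricities *)

Section Metric.
Variable G : sgraph.
Implicit Types (u v w : G) (S : {set G}).

Lemma dist_leP k u v :
  reflect (exists2 j, j <= k & walk j u v) (dist u v <= Fin k)%O.
Proof. exact: min_nat_leP. Qed.

Lemma dist_le0 u v : (dist u v <= Fin 0)%O = (u == v).
Proof.
apply/dist_leP/eqP => [[j]|->]; last by exists 0 => //; exists [::].
by rewrite leqn0 => /eqP-> [[|x s] []].
Qed.

Lemma distxx u : dist u u = Fin 0.
Proof. by apply/le_anti; rewrite dist_le0 eqxx; case: dist. Qed.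

Lemma walk_sym k u v : walk k u v -> walk k v u.
Proof.
case=> s [<- us <-]; exists (rev (belast u s)).
rewrite size_rev size_belast rev_path; split=> //.
  by rewrite (eq_path (e' := adj)) // => x y; apply: adj_sym.
by case: s {us} => //= x s; rewrite rev_cons last_rcons.
Qed.

Lemma dist_sym u v : dist u v = dist v u.
Proof.
suff dist_le (x y : G) : (dist x y <= dist y x)%O by apply/le_anti; rewrite !dist_le.
case E: (dist y x) => [k|]; last by case: dist.
by apply/dist_leP; exists k => //; apply: walk_sym; apply: min_natP E.
Qed.

(** The triangle inequality, phrased through finite bounds so that extended naturals never have to
    be added. *)
Lemma dist_trans w u v a b k : a + b <= k ->
  (dist u w <= Fin a)%O -> (dist w v <= Fin b)%O -> (dist u v <= Fin k)%O.
Proof.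
move=> abk /dist_leP[i ia [s [si us su]]] /dist_leP[j jb [t [tj wt tv]]].
apply/dist_leP; exists (i + j); first exact: leq_trans (leq_add ia jb) abk.
by exists (s ++ t); rewrite size_cat cat_path last_cat si tj us su.
Qed.

Lemma dist_leSP k u v :
  reflect (u = v \/ exists2 w, adj u w & (dist w v <= Fin k)%O)
          (dist u v <= Fin k.+1)%O.
Proof.
apply: (iffP (dist_leP _ _ _)) => [[j jk [[|w s] [sj us sv]]]|].
- by left.
- right; exists w; first by case/andP: us.
  apply/dist_leP; exists (size s); first by rewrite -ltnS (leq_trans _ jk) // -sj.
  by exists s; case/andP: us.
- case=> [->|[w uw /dist_leP[j jk [s [sj ws sv]]]]].
    by exists 0 => //; exists [::].
  by exists j.+1 => //; exists (w :: s); rewrite /= sj uw ws.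
Qed.

Lemma dist_le1 u v : (dist u v <= Fin 1)%O = (u == v) || adj u v.
Proof.
apply/dist_leSP/orP => [[->|[w uw]]|[/eqP->|uv]]; first by rewrite eqxx; left.
- by rewrite dist_le0 => /eqP <-; right.
- by left.
- by right; exists v => //; rewrite dist_le0.
Qed.

Lemma dist_le2P u v :
  reflect [\/ u = v, adj u v | exists2 w, adj u w & adj w v]
          (dist u v <= Fin 2)%O.
Proof.
apply: (iffP (dist_leSP _ _ _)) => [[->|[w uw]]|[->|uv|[w uw wv]]].
- by constructor 1.
- rewrite dist_le1 => /orP[/eqP<-|wv]; first by constructor 2.
  by constructor 3; exists w.
- by left.
- by right; exists v => //; rewrite distxx.
- by right; exists w => //; rewrite dist_le1 wv orbT.
Qed.

Lemma dist_set_geP k v S :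
  reflect (forall s, s \in S -> ~~ (dist v s <= Fin k)%O)
          (Fin k.+1 <= dist_set v S)%O.
Proof.
apply: (iffP idP) => [+ s sS|far].
  rewrite -FinS_le => /le_trans; apply.
  by rewrite /dist_set (bigD1 s) //= ge_min lexx.
rewrite /dist_set; elim/big_ind: _ => // [x y kx ky|s sS].
  by rewrite le_min kx ky.
by rewrite FinS_le far.
Qed.

Lemma dist_le_ecc u v : (dist u v <= ecc v)%O.
Proof. by rewrite /ecc (bigD1 u) //= le_max lexx. Qed.

Lemma ecc_leP k v :
  reflect (forall u, (dist u v <= Fin k)%O) (ecc v <= Fin k)%O.
Proof.
apply: (iffP idP) => [vk u|dk]; first exact: le_trans (dist_le_ecc u v) vk.
rewrite /ecc; elim/big_ind: _ => // x y xk yk.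
by rewrite ge_max xk yk.
Qed.

Lemma ecc_gtP k v : ~~ (ecc v <= Fin k)%O -> exists u, ~~ (dist u v <= Fin k)%O.
Proof.
move=> vk; apply/existsP; apply: contraR vk => /existsPn dk.
by apply/ecc_leP => u; move: (dk u); rewrite negbK.
Qed.

Lemma centerP v : reflect (forall u, (ecc v <= ecc u)%O) (v \in center G).
Proof. by rewrite inE; apply: forallP. Qed.

Lemma ecc_center c c' : c \in center G -> c' \in center G -> ecc c = ecc c'.
Proof. by move=> /centerP cP /centerP c'P; apply/le_anti; rewrite cP c'P. Qed.

End Metric.

(** Used for the embedding of [P] as the centered periphery: a walk in [P] is a walk in [H], so a
    large distance in [H] forces one in [P]. *)
Lemma dist_hom (G H : sgraph) (g : G -> H) u v k :
  {homo g : x y / adj x y} ->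
  (dist u v <= Fin k)%O -> (dist (g u) (g v) <= Fin k)%O.
Proof.
move=> gadj /dist_leP[j jk [s [sj us sv]]]; apply/dist_leP; exists j => //.
exists (map g s); rewrite size_map last_map sv; split=> //.
exact: homo_path us.
Qed.

(** * From uniform central graphs to coverings *)

Lemma iso_induced_embedding (G H : sgraph) (S : {set H}) :
  iso (induced S) G ->
  exists g : G -> H, [/\ forall x y, adj (g x) (g y) = adj x y,
    forall x, g x \in S & forall y, y \in S -> exists x, y = g x].
Proof.
case=> f [f' fK f'K] fadj; exists (fun x => val (f' x)); split.
- by move=> x y; rewrite -{2}(f'K x) -{2}(f'K y) fadj.
- by move=> x; apply: valP.
- by move=> y yS; exists (f (Sub y yS)); rewrite fK.
Qed.

Lemma complete_center_adj (H : sgraph) n : iso (induced (center H)) (complete n) ->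
  {in center H &, forall z z', z != z' -> adj z z'}.
Proof.
move=> /iso_induced_embedding[g [gadj _ gsurj]] z z' /gsurj[i ->] /gsurj[j ->] gij.
by rewrite gadj /= /complete_adj; apply: contraNneq gij => ->.
Qed.

(** The disjunction fits minimality: if [#|intermediate H|] is already the least size for condition
    A, the strict alternative fails and condition B remains. *)
Lemma UCG_covering (H P : sgraph) n : 2 <= n -> 0 < #|P| ->
  UCG H -> iso (induced (center H)) (complete n) -> iso (induced (CP H)) P ->
  exists k (F : 'I_k -> {set P}), [/\ covering F, condA F &
    k < #|intermediate H| \/ k <= #|intermediate H| /\ condB F].
Proof.
move=> n2 /card_gt0P[p0 _] ucgH isoZ isoP.
have Zadj := complete_center_adj isoZ.
have distZ z z' : z \in center H -> z' \in center H -> (dist z z' <= Fin 1)%O.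
  move=> zZ z'Z; rewrite dist_le1; case: eqVneq => //= zz'; exact: Zadj.
have [c [c' [cZ c'Z cc']]] : exists c c', [/\ c \in center H, c' \in center H & adj c c'].
  have [g [gadj gZ _]] := iso_induced_embedding isoZ.
  exists (g (Ordinal (ltnW n2))), (g (Ordinal n2)).
  by rewrite gadj !gZ.
have [g [gadj gCP gsurj]] := iso_induced_embedding isoP.
have ECc : CP H = EC c.
  apply/setP => x; apply/bigcupP/idP => [[z zZ]|xc]; last by exists c.
  by rewrite (ucgH _ _ zZ cZ).
(* Were the radius infinite, every vertex would be central, so [H] would be complete and of radius
   at most 1. *)
have [r eccc] : exists r, ecc c = Fin r.
  case Ec: (ecc c) => [r|]; first by exists r.
  have : (ecc c <= Fin 1)%O.
    apply/ecc_leP => u; apply: distZ => //; apply/centerP => w.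
    move/centerP: cZ => /(_ w); rewrite Ec.
    by case: (ecc w) => // _; case: (ecc u).
  by rewrite Ec.
have distCP z p : z \in center H -> dist z (g p) = Fin r.
  move=> zZ; apply/eqP; rewrite -eccc (ecc_center cZ zZ).
  by have := gCP p; rewrite ECc (ucgH _ _ cZ zZ) inE.
have dist_r x : (dist c x <= Fin r)%O by rewrite -eccc dist_sym dist_le_ecc.
(* Radius 0 would identify [c] and [c']; radius 1 would put [c'] in [EC c], which by uniformity is
   [EC c']. *)
have [r' Er r'0] : exists2 r', r = r'.+1 & 0 < r'.
  case: r eccc distCP dist_r => [|[|r]] eccc _ dist_r; last by exists r.+1.
    by move: (dist_r c') cc'; rewrite dist_le0 => /eqP->; rewrite adj_irr.
  have : c' \in EC c.
    rewrite inE eccc; apply/eqP/le_anti; rewrite dist_r FinS_le dist_le0.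
    by apply: contraTneq cc' => ->; rewrite adj_irr.
  by rewrite (ucgH _ _ cZ c'Z) inE distxx -(ecc_center cZ c'Z) eccc.
move: eccc distCP dist_r; rewrite {r}Er => eccc distCP dist_r.
have inCP x : (x \in CP H) = ~~ (dist c x <= Fin r')%O.
  by rewrite ECc inE eccc -FinS_le eq_le dist_r.
have ecc_gt x : x \notin center H -> ~~ (ecc x <= Fin r'.+1)%O.
  apply: contra; rewrite -eccc => xc; apply/centerP => u.
  by apply: le_trans xc _; apply/centerP.
pose N := [set v | adj c v] :\: center H.
have NI : N \subset intermediate H.
  apply/subsetP => v; rewrite in_setD in_setC in_setU inE => /andP[vZ cv].
  rewrite negb_or vZ inCP negbK.
  by apply: le_trans (_ : (_ <= Fin 1)%O) _; rewrite ?dist_le1 ?cv ?orbT.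
pose F (i : 'I_#|N|) := [set p | (dist (enum_val i) (g p) <= Fin r')%O].
have inF v p : v \in N -> exists2 i : 'I_#|N|,
    enum_val i = v & (p \in F i) = (dist v (g p) <= Fin r')%O.
  by move=> vN; exists (enum_rank_in vN v); rewrite ?inE ?enum_rankK_in.
have ghom : {homo g : x y / adj x y} by move=> x y; rewrite gadj.
exists #|N|, F; split.
- apply/setP => p; rewrite inE; apply/bigcupP.
  (* The first step [w] of a geodesic from [c] to [g p] is not central, as central vertices are at
     distance [r'.+1] from [g p]. *)
  have /dist_leSP[cp|[w cw wp]] : (dist c (g p) <= Fin r'.+1)%O by rewrite distCP.
    by move: (gCP p); rewrite -cp inCP distxx.
  have wN : w \in N.
    rewrite in_setD inE cw andbT; apply/negP => wZ.
    by move: wp; rewrite distCP // le_Fin ltnn.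
  by have [i _ pi] := inF w p wN; exists i; rewrite ?pi.
- move=> i; have := enum_valP i; set v := enum_val i.
  rewrite in_setD inE => /andP[/ecc_gt/ecc_gtP[x vx] cv].
  have dvc : (dist v c <= Fin 1)%O by rewrite dist_sym dist_le1 cv orbT.
  have /gsurj[p Ep] : x \in CP H.
    rewrite inCP; apply: contra vx => cx; rewrite dist_sym.
    exact: dist_trans dvc cx.
  move: vx; rewrite Ep dist_sym => vx.
  exists p; first by rewrite inE; apply: contra vx => /le_trans; apply; rewrite le_Fin.
  apply/dist_set_geP => s; rewrite inE => vs; apply: contra vx => ps.
  apply: dist_trans vs _; last by rewrite dist_sym; apply: dist_hom ps.
  by rewrite addn1.
(* The radius is [r'.+1]: the cases are radius at least 3 and radius 2. *)
case: (ltngtP r' 1) r'0 => // [r'1|r'1] _; [left|right; split].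
(* The vertex [w] before [g p0] on a geodesic from [c] is too close to [c] to be peripheral; within
   distance 1 of [c] it would give [g p0] distance at most 2 from [c], hence at most [r']. *)
- have [w cw wp] : exists2 w, adj (g p0) w & (dist w c <= Fin r')%O.
    have : (dist (g p0) c <= Fin r'.+1)%O by rewrite dist_sym distCP.
    case/dist_leSP => [cp|//].
    by move: (gCP p0); rewrite cp inCP distxx.
  have cw1 : ~~ (dist c w <= Fin 1)%O.
    have := gCP p0; rewrite inCP; apply: contra => cw1.
    by apply: (dist_trans (a := 1) (b := 1) r'1 cw1); rewrite dist_sym dist_le1 cw orbT.
  apply: proper_card; apply/properP; split=> //; exists w.
    rewrite in_setC in_setU inCP negb_or negbK dist_sym wp andbT.
    by apply: contra cw1 => /(distZ _ _ cZ).
  by rewrite in_setD inE; apply: contra cw1 => /andP[_]; rewrite dist_le1 orbC => ->.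
- exact: subset_leq_card.
subst r' => i p; rewrite inE => ip.
have pZ : g p \notin center H.
  by have := gCP p; rewrite inCP; apply: contra => /(distZ _ _ cZ).
have [x px] := ecc_gtP (ecc_gt _ pZ).
(* A vertex [x] at distance over 2 from [g p] yields one alternative of condition B: a peripheral
   [x] is the vertex [p'], any other lies in [N] and indexes the member [F j]. *)
have [/gsurj[p' Ep']|xCP] := boolP (x \in CP H); [left|right].
  move: px; rewrite {x}Ep' => px; exists p'.
    by rewrite inE; apply: contra px; rewrite dist_sym => ip'; apply: dist_trans ip' ip.
  by rewrite FinS_le; apply: contra px; rewrite dist_sym; apply: dist_hom.
have xN : x \in N.
  move: xCP; rewrite inCP negbK dist_le1 => /orP[/eqP cx|cx].
    by move: px; rewrite -cx distCP.
  rewrite in_setD inE cx andbT; apply: contra px => xZ.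
  by rewrite distCP.
have [j jx _] := inF x p xN; exists j.
  by apply: contra px => /eqP ji; rewrite -jx ji; apply: le_trans ip _.
apply/dist_set_geP => s; rewrite inE jx => xs; apply: contra px => ps.
by apply: dist_trans xs _; last by rewrite dist_sym; apply: dist_hom ps.
Qed.

(** * From coverings to uniform central graphs *)

Section Construction.
Variables (n k : nat) (P : sgraph) (owner : P -> 'I_k).

Definition cone_vertex : finType := ('I_n + ('I_k + P))%type.

(* [K_n] is joined to an independent set of hubs, and each vertex of [P] is
   attached to exactly one hub. *)
Definition cone_adj (x y : cone_vertex) : bool :=
  match x, y with
  | inl a, inl b => a != b
  | inl _, inr (inl _) | inr (inl _), inl _ => true
  | inr (inl i), inr (inr p) | inr (inr p), inr (inl i) => owner p == i
  | inr (inr p), inr (inr q) => adj p q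
  | _, _ => false
  end.

Lemma cone_adj_sym : symmetric cone_adj.
Proof.
by move=> [a|[i|p]] [b|[j|q]] //=; rewrite 1?eq_sym // adj_sym.
Qed.

Lemma cone_adj_irr : irreflexive cone_adj.
Proof. by move=> [a|[i|p]] //=; rewrite ?eqxx ?adj_irr. Qed.

Definition cone := SGraph cone_adj_sym cone_adj_irr.

Definition apex (a : 'I_n) : cone := inl a.
Definition hub (i : 'I_k) : cone := inr (inl i).
Definition rim (p : P) : cone := inr (inr p).

Lemma dist_apex_rim a p : dist (apex a) (rim p) = Fin 2.
Proof.
apply/le_anti; rewrite FinS_le dist_le1 /= andbT.
by apply/dist_le2P; constructor 3; exists (hub (owner p)) => /=.
Qed.

Lemma dist_apex_le1 a x :
  (dist (apex a) x <= Fin 1)%O = if x is inr (inr _) then false else true.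
Proof.
by case: x => [b|[i|p]]; rewrite dist_le1 //=; case: eqVneq => //= ->.
Qed.

(** Conditions A and B enter the cone as these two hypotheses, which exclude hubs and rim vertices
    from the center. *)
Hypothesis hub_far : forall i, exists x, ~~ (dist (hub i) x <= Fin 2)%O.
Hypothesis rim_far : forall p, exists x, ~~ (dist (rim p) x <= Fin 2)%O.
Hypotheses (n_gt0 : 0 < n) (P_gt0 : 0 < #|P|).

Lemma ecc_apex a : ecc (apex a) = Fin 2.
Proof.
apply/le_anti/andP; split.
  apply/ecc_leP => x; rewrite dist_sym.
  have [/le_trans->//|] := boolP (dist (apex a) x <= Fin 1)%O.
  rewrite dist_apex_le1.
  by case: x => [|[|p]] // _; rewrite dist_apex_rim.
have /card_gt0P[p _] := P_gt0.
by rewrite -(dist_apex_rim a p) dist_sym dist_le_ecc.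
Qed.

Lemma ecc_cone_le2 x :
  (ecc (x : cone) <= Fin 2)%O = if x is inl _ then true else false.
Proof.
have far y : (exists z, ~~ (dist y z <= Fin 2)%O) -> (ecc (y : cone) <= Fin 2)%O = false.
  by case=> z yz; apply/ecc_leP => /(_ z); rewrite dist_sym; apply/negP.
case: x => [a|[i|p]]; first by rewrite (ecc_apex a).
  by apply: far; apply: hub_far.
by apply: far; apply: rim_far.
Qed.

Lemma center_cone : center cone = [set apex a | a in 'I_n].
Proof.
apply/setP => x; apply/centerP/imsetP => [xmin|[a _ ->] u].
  have := xmin (apex (Ordinal n_gt0)); rewrite ecc_apex ecc_cone_le2.
  by case: x {xmin} => // a _; exists a.
have [[b ->]|] : (exists b, u = apex b) \/ ~~ (ecc u <= Fin 2)%O.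
- by rewrite ecc_cone_le2; case: u => [b|y]; [left; exists b|right].
- by rewrite !ecc_apex.
- by rewrite ecc_apex -ltNge => /ltW.
Qed.

Lemma EC_apex a : EC (apex a) = [set rim p | p in P].
Proof.
apply/setP => x; rewrite inE ecc_apex; apply/eqP/imsetP => [ax|[p _ ->]].
  have := dist_apex_le1 a x; rewrite ax.
  by case: x {ax} => [b|[i|p]] // _; exists p.
exact: dist_apex_rim.
Qed.

Lemma CP_cone : CP cone = [set rim p | p in P].
Proof.
rewrite /CP center_cone; apply/setP => x; apply/bigcupP/idP => [[z /imsetP[a _ ->]]|xP].
  by rewrite EC_apex.
by exists (apex (Ordinal n_gt0)); rewrite ?EC_apex // imset_f.
Qed.

Lemma UCG_cone : UCG cone.
Proof.
move=> c c'; rewrite center_cone => /imsetP[a _ ->] /imsetP[b _ ->].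
by rewrite !EC_apex.
Qed.

Lemma intermediate_cone : intermediate cone = [set hub i | i in 'I_k].
Proof.
apply/setP => x; rewrite /intermediate center_cone CP_cone !inE.
case: x => [a|[i|p]].
- rewrite [X in X || _](imset_f apex) //=; by apply/esym/imsetP => -[].
- rewrite [RHS](imset_f hub) //; apply/norP; split; by apply/imsetP => -[].
- rewrite [X in _ || X](imset_f rim) ?orbT //=; by apply/esym/imsetP => -[].
Qed.

End Construction.

Lemma iso_induced_image (G H : sgraph) (f : G -> H) (S : {set H}) :
  injective f -> (forall x y, adj (f x) (f y) = adj x y) ->
  S = [set f x | x in G] -> iso (induced S) G.
Proof.
move=> finj fadj SE.
have fS x : f x \in S by rewrite SE imset_f.
pose h x : induced S := exist _ (f x) (fS x).
have hinj : injective h by move=> x y /(congr1 val)/finj.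
have hbij : bijective h.
  apply: inj_card_bij => //.
  by rewrite card_sig [in leqLHS]SE (eq_card (B := mem [set f x | x in G])) // card_imset.
case: hbij => h' hK h'K; exists h'; first by exists h.
by move=> x y; rewrite -fadj -{2}(h'K x) -{2}(h'K y).
Qed.

(* Shrinking the members of a covering preserves both conditions, so each vertex
   of [P] may be assigned to a single member. *)
Lemma covering_UCG (P : sgraph) n k (F : 'I_k -> {set P}) : 0 < n -> 0 < #|P| ->
  covering F -> condA F -> condB F ->
  exists H : sgraph, [/\ UCG H, iso (induced (center H)) (complete n),
    iso (induced (CP H)) P & #|intermediate H| = k].
Proof.
move=> n0 P0 covF FA FB.
have /choice[owner ownerP] (p : P) : exists i, p \in F i.
  by have : p \in \bigcup_i F i; [rewrite covF|case/bigcupP => i _; exists i].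
(* No apex is adjacent to the rim, so a path of length at most 2 from hub [i] to [p] uses a vertex
   owned by [i], hence in [F i], equal or adjacent to [p]. *)
have hub_rim i p : p \notin F i -> (forall q, q \in F i -> ~~ (dist p q <= Fin 1)%O) ->
    ~~ (dist (hub n owner i) (rim n owner p) <= Fin 2)%O.
  move=> pi far; apply/dist_le2P => -[//|/= /eqP pe|[[a|[j|q]] //= /eqP qe qp]].
    by move: pi; rewrite -pe ownerP.
  by have := far q; rewrite -qe ownerP dist_le1 adj_sym qp orbT => /(_ isT).
have hub_far i : exists x, ~~ (dist (hub n owner i) x <= Fin 2)%O.
  have [p pi /dist_set_geP far] := FA i.
  by exists (rim n owner p); apply: hub_rim.
have rim_far p : exists x, ~~ (dist (rim n owner p) x <= Fin 2)%O.
  have [[p' p'i pp']|[j _ /dist_set_geP pj]] := FB _ _ (ownerP p).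
    exists (rim n owner p'); move: pp'; rewrite FinS_le; apply: contra.
    (* A path of length 2 leaving [P] would pass through a common hub, but [p'] is not in the member
       that owns [p]. *)
    case/dist_le2P => [[->]|pp'|[[a|[j|q]] //= pq qp']].
    - by rewrite distxx.
    - by apply/dist_le2P; constructor 2.
    - by move: p'i; rewrite (eqP pq) -(eqP qp') ownerP.
    - by apply/dist_le2P; constructor 3; exists q.
  exists (hub n owner j); rewrite dist_sym; apply: hub_rim => //.
  by apply/negP => /pj; rewrite distxx.
exists (cone n owner); split.
- exact: UCG_cone.
- apply: (@iso_induced_image (complete n) _ (@apex n k P owner)) => [a b []//|//|].
  exact: center_cone.
- apply: (@iso_induced_image P _ (@rim n k P owner)) => [p q []//|//|].
  exact: CP_cone.
- by rewrite intermediate_cone // card_imset ?card_ord // => i j [].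
Qed.

Theorem theorem3p3 (n : nat) (P : sgraph)
    (n_ge2 : 2 <= n)
    (P_nonempty : 0 < #|P|)
    (P_coverable : exists (k : nat) (F : 'I_k -> {set P}), covering F /\ condA F)
    (kappa : enat) (kappaE : kappa = cov_A P) :
  A_ucg (complete n) P = kappa <-> cov_AB P = kappa.
Proof.
have [k kE] : exists k, kappa = Fin k.
  case: P_coverable => j [F [covF FA]].
  have : (kappa <= Fin j)%O by rewrite kappaE; apply: min_nat_le; exists F.
  by case: kappa {kappaE} => // k _; exists k.
have kmin j (F : 'I_j -> {set P}) : covering F -> condA F -> k <= j.
  by move=> covF FA; rewrite -le_Fin -kE kappaE; apply: min_nat_le; exists F.
rewrite kE; split=> [/min_natP[H [ucgH isoZ isoP HI]]|/min_natP[F [covF FA FB]]].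
  have [j [F [covF FA FI]]] := UCG_covering n_ge2 P_nonempty ucgH isoZ isoP.
  (* Here [k] is both the least size for condition A and [#|intermediate H|], so the strict
     alternative is impossible. *)
  have kj := kmin _ _ covF FA; rewrite HI in FI.
  case: FI => [jk|[jk FB]]; first by rewrite ltnNge kj in jk.
  apply: min_nat_eqFin => [|i [F' [? ? _]]]; last exact: (kmin _ F').
  have -> : k = j by apply/eqP; rewrite eqn_leq kj jk.
  by exists F.
apply: min_nat_eqFin; first exact: covering_UCG (ltnW n_ge2) P_nonempty covF FA FB.
move=> m [H [ucgH isoZ isoP <-]].
have [j [F' [covF' FA' FI]]] := UCG_covering n_ge2 P_nonempty ucgH isoZ isoP.
apply: leq_trans (kmin _ _ covF' FA') _.
by case: FI => [/ltnW|[]].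
Qed.
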